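(* Let $c_1,c_2>0$, let the two blocks be discretized by summation-by-parts operators as described in the context, and let $I_{v2u}\in\mathbb{R}^{m_y^{(u)}\times m_y^{(v)}}$, $I_{u2v}\in\mathbb{R}^{m_y^{(v)}\times m_y^{(u)}}$ be a norm-compatible pair of interpolation operators, i.e. $(I_{v2u}b)^\top H^{(u)}a=b^\top H^{(v)}(I_{u2v}a)$ for all $a\in\mathbb{R}^{m_y^{(u)}}$, $b\in\mathbb{R}^{m_y^{(v)}}$. Put $$L=\begin{bmatrix} e_E^{(u)} & -I_{v2u}\,e_W^{(v)}\\ c_1^2 I_{u2v}\,d_E^{(u)} & -c_2^2\, d_W^{(v)}\end{bmatrix},\qquad P=I-\hat H^{-1}L^\top(L\hat H^{-1}L^\top)^{-1}L .$$ Then the system of ordinary differential equations $$w_{tt}=P\,D\,P\,w,\qquad w=\begin{bmatrix}u\\ v\end{bmatrix},$$ is a stable approximation of the two-block wave equation with a non-conforming interface, in the following sense: for every solution $w(t)$, $t\ge 0$, writing $\hat w=\begin{bmatrix}\hat u\\ \hat v\end{bmatrix}=Pw$, the quantity $$E=u_t^\top\bar H^{(u)}u_t+c_1^2\,\hat u^\top\big(H_y^{(u)}M_x^{(u)}+H_x^{(u)}M_y^{(u)}\big)\hat u+v_t^\top\bar H^{(v)}v_t+c_2^2\,\hat v^\top\big(H_y^{(v)}M_x^{(v)}+H_x^{(v)}M_y^{(v)}\big)\hat v$$ satisfies $E\ge 0$ and $\frac{d}{dt}E=0$.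
   Context: **Continuous problem.** A rectangle is split by a vertical interface $\partial\Omega_I$ into a left block $\Omega_L$ and a right block $\Omega_R$. The problem is $u_{tt}=c_1^2\Delta u$ in $\Omega_L$, $v_{tt}=c_2^2\Delta v$ in $\Omega_R$, Neumann conditions on the outer boundaries (taken homogeneous for the stability analysis), and interface conditions $u=v$, $c_1^2u_x=c_2^2v_x$ on $\partial\Omega_I$. **One-dimensional operators.** For each block and each coordinate direction with $m\ge 2$ equidistant grid points there is a second-derivative summation-by-parts operator $$D_2=H^{-1}(-M+e_rd_r^\top-e_ld_l^\top)\in\mathbb{R}^{m\times m},$$ where $H$ is diagonal positive definite, $M$ is symmetric positive semi-definite, $e_l^\top,e_r^\top$ are the row vectors extracting the first and last entries, and $d_l^\top,d_r^\top$ are row vectors giving consistent approximations of the first derivative at the first and last grid points (in particular they give $0$ on constant grid vectors and $1$ on the vector of grid coordinates). $D_2$ approximates the second derivative. The operators may differ between directions and between blocks (sizes and grid spacings differ). **Two-dimensional operators.** In a block with $m_x\times m_y$ grid points, solution vectors lie in $\mathbb{R}^{m_xm_y}$ and are ordered column-major. In each Kronecker product below, the one-dimensional operator is that of the corresponding direction: - $D_{2x}=D_2\otimes I_{m_y}$, $D_{2y}=I_{m_x}\otimes D_2$ - $H_x=H\otimes I_{m_y}$, $H_y=I_{m_x}\otimes H$ - $M_x=M\otimes I_{m_y}$, $M_y=I_{m_x}\otimes M$ - $e_W=e_l^\top\otimes I_{m_y}$, $e_E=e_r^\top\otimes I_{m_y}$, $e_S=I_{m_x}\otimes e_l^\top$,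 $e_N=I_{m_x}\otimes e_r^\top$ - $d_W=d_l^\top\otimes I_{m_y}$, $d_E=d_r^\top\otimes I_{m_y}$, $d_S=I_{m_x}\otimes d_l^\top$, $d_N=I_{m_x}\otimes d_r^\top$ - $\bar H=H_xH_y$ Superscripts $(u)$ and $(v)$ denote operators of the left and right block, respectively. $H^{(u)}\in\mathbb{R}^{m_y^{(u)}\times m_y^{(u)}}$ and $H^{(v)}\in\mathbb{R}^{m_y^{(v)}\times m_y^{(v)}}$ denote the one-dimensional $y$-direction matrices $H$ of the two blocks (the inner products along the interface). The interface is the east side of the left block and the west side of the right block. The numbers $m_y^{(u)}$ and $m_y^{(v)}$ need not be equal (non-conforming grids). $I_{u2v}$ and $I_{v2u}$ interpolate interface grid functions from left to right and from right to left, respectively. **Discrete Laplacians.** The discrete Laplacians are $D_{2x}+D_{2y}$ plus penalty terms weakly imposing the homogeneous Neumann conditions on the outer (non-interface) sides only: $$D_L^{(u)}=D_{2x}+D_{2y}+H_x^{-1}e_W^\top d_W+H_y^{-1}e_S^\top d_S-H_y^{-1}e_N^\top d_N\quad\text{(all operators of block }(u)),$$ $$D_L^{(v)}=D_{2x}+D_{2y}-H_x^{-1}e_E^\top d_E+H_y^{-1}e_S^\top d_S-H_y^{-1}e_N^\top d_N\quad\text{(all operators of block }(v)).$$ **Global operators.** $$D=\begin{bmatrix}c_1^2D_L^{(u)}&0\\0&c_2^2D_L^{(v)}\end{bmatrix},\qquad \hat H=\begin{bmatrix}\bar H^{(u)}&0\\0&\bar H^{(v)}\end{bmatrix}.$$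 The condition $Lw=0$ discretizes the interface conditions. *)

(* Defs.v *)
From mathcomp Require Import all_boot all_order all_algebra.
From mathcomp Require Import all_classical all_reals all_analysis.
From mathcomp Require Import mxtens.

Set Implicit Arguments.
Unset Strict Implicit.
Unset Printing Implicit Defensive.

Import Order.TTheory GRing.Theory Num.Theory.
Import numFieldNormedType.Exports.

Local Open Scope classical_set_scope.
Local Open Scope ring_scope.

(* Derivative relative to a set: the difference quotient is taken over s in A,
   s != t only. With A = `[0, +oo[ this is the ordinary derivative for t > 0
   and the right-hand derivative for t = 0. *)
Definition has_derivative_within (R : realType) (V : normedModType R)
    (A : set R) (f : R -> V) (t : R) (l : V) : Prop :=
  ((s - t)^-1 *: (f s - f t)) @[s --> within A (t^')] --> l.

Definition qform (R : realType) (n : nat) (A : 'M[R]_n) (x : 'cV[R]_n) : R :=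
  (x^T *m A *m x) 0 0.

Definition posdefmx (R : realType) (n : nat) (A : 'M[R]_n) : Prop :=
  forall x : 'cV[R]_n, x != 0 -> 0 < qform A x.

Definition possemidefmx (R : realType) (n : nat) (A : 'M[R]_n) : Prop :=
  forall x : 'cV[R]_n, 0 <= qform A x.

Definition grid (R : realType) (m : nat) (a b : R) : 'cV[R]_m :=
  \col_(i < m) (a + i%:R * ((b - a) / m.-1%:R)).

(* The rows e_l^T and e_r^T. *)
Definition rowl (R : realType) (m : nat) : 'rV[R]_m :=
  \row_(j < m) ((j : nat) == 0)%:R.

Definition rowr (R : realType) (m : nat) : 'rV[R]_m :=
  \row_(j < m) ((j : nat) == m.-1)%:R.

(* Summation-by-parts operator on m equidistant points of [a, b]; sbp_dl and
   sbp_dr are the rows d_l^T and d_r^T. *)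
Record sbp_operator (R : realType) (m : nat) (a b : R) := SbpOperator {
  sbp_H : 'M[R]_m;
  sbp_M : 'M[R]_m;
  sbp_dl : 'rV[R]_m;
  sbp_dr : 'rV[R]_m;
  sbp_H_diag : is_diag_mx sbp_H;
  sbp_H_posdef : posdefmx sbp_H;
  sbp_M_sym : sbp_M^T = sbp_M;
  sbp_M_psd : possemidefmx sbp_M;
  sbp_dl_const : sbp_dl *m const_mx 1 = 0 :> 'M[R]_1;
  sbp_dl_grid : sbp_dl *m grid m a b = 1%:M :> 'M[R]_1;
  sbp_dr_const : sbp_dr *m const_mx 1 = 0 :> 'M[R]_1;
  sbp_dr_grid : sbp_dr *m grid m a b = 1%:M :> 'M[R]_1
}.

Definition sbp_D2 (R : realType) (m : nat) (a b : R)
    (O : sbp_operator m a b) : 'M[R]_m :=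
  invmx (sbp_H O) *m
    (- sbp_M O + (rowr R m)^T *m sbp_dr O - (rowl R m)^T *m sbp_dl O).

(* [A *t B] is the Kronecker product, with (i, j) at position i * my + j, so
   that a vector of size mx * my is a grid function ordered column-major.
   A one-dimensional row acting in one direction maps to functions on a side;
   the casts only identify 1 * my with my and mx * 1 with mx. *)
Section TwoDimensionalOperators.

Context (R : realType) (mx my : nat).

Definition xmx (A : 'M[R]_mx) : 'M[R]_(mx * my) := A *t (1%:M : 'M[R]_my).
Definition ymx (A : 'M[R]_my) : 'M[R]_(mx * my) := (1%:M : 'M[R]_mx) *t A.

Definition xrow (r : 'rV[R]_mx) : 'M[R]_(my, mx * my) :=
  castmx (mul1n my, erefl) (r *t (1%:M : 'M[R]_my)).
Definition yrow (r : 'rV[R]_my) : 'M[R]_(mx, mx * my) :=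
  castmx (muln1 mx, erefl) ((1%:M : 'M[R]_mx) *t r).

Context (xa xb ya yb : R).
Context (X : sbp_operator mx xa xb) (Y : sbp_operator my ya yb).

Definition D2x := xmx (sbp_D2 X).
Definition D2y := ymx (sbp_D2 Y).
Definition Hx := xmx (sbp_H X).
Definition Hy := ymx (sbp_H Y).
Definition Mx := xmx (sbp_M X).
Definition My := ymx (sbp_M Y).
Definition eW := xrow (rowl R mx).
Definition eE := xrow (rowr R mx).
Definition eS := yrow (rowl R my).
Definition eN := yrow (rowr R my).
Definition dW := xrow (sbp_dl X).
Definition dE := xrow (sbp_dr X).
Definition dS := yrow (sbp_dl Y).
Definition dN := yrow (sbp_dr Y).
Definition Hbar := Hx *m Hy.

Definition lap_left : 'M[R]_(mx * my) :=
  D2x + D2y + invmx Hx *m eW^T *m dW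
  + invmx Hy *m eS^T *m dS - invmx Hy *m eN^T *m dN.

Definition lap_right : 'M[R]_(mx * my) :=
  D2x + D2y - invmx Hx *m eE^T *m dE
  + invmx Hy *m eS^T *m dS - invmx Hy *m eN^T *m dN.

End TwoDimensionalOperators.

Arguments eW R mx my : clear implicits.
Arguments eE R mx my : clear implicits.
Arguments eS R mx my : clear implicits.
Arguments eN R mx my : clear implicits.

(* Xu, Yu and Xv, Yv are the x- and y-direction operators of the left block
   [xL, xI] x [yS, yN] and of the right block [xI, xR] x [yS, yN]. *)
Section TwoBlocks.

Context (R : realType) (mxu myu mxv myv : nat) (xL xI xR yS yN : R).
Context (Xu : sbp_operator mxu xL xI) (Yu : sbp_operator myu yS yN).
Context (Xv : sbp_operator mxv xI xR) (Yv : sbp_operator myv yS yN).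

Definition norm_compatible (Iv2u : 'M[R]_(myu, myv))
    (Iu2v : 'M[R]_(myv, myu)) : Prop :=
  forall (a : 'cV[R]_myu) (b : 'cV[R]_myv),
    (Iv2u *m b)^T *m sbp_H Yu *m a = b^T *m sbp_H Yv *m (Iu2v *m a).

Context (c1 c2 : R) (Iv2u : 'M[R]_(myu, myv)) (Iu2v : 'M[R]_(myv, myu)).

Definition globalD : 'M[R]_(mxu * myu + mxv * myv) :=
  block_mx (c1 ^+ 2 *: lap_left Xu Yu) 0 0 (c2 ^+ 2 *: lap_right Xv Yv).

Definition globalH : 'M[R]_(mxu * myu + mxv * myv) :=
  block_mx (Hbar Xu Yu) 0 0 (Hbar Xv Yv).

Definition interfaceL : 'M[R]_(myu + myv, mxu * myu + mxv * myv) :=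
  block_mx (eE R mxu myu) (- (Iv2u *m eW R mxv myv))
           (c1 ^+ 2 *: (Iu2v *m dE myu Xu)) (- (c2 ^+ 2 *: dW myv Xv)).

Definition energy (wt what : 'cV[R]_(mxu * myu + mxv * myv)) : R :=
  qform (Hbar Xu Yu) (usubmx wt)
  + c1 ^+ 2 * qform (Hy mxu Yu *m Mx myu Xu + Hx myu Xu *m My mxu Yu)
                    (usubmx what)
  + qform (Hbar Xv Yv) (dsubmx wt)
  + c2 ^+ 2 * qform (Hy mxv Yv *m Mx myv Xv + Hx myv Xv *m My mxv Yv)
                    (dsubmx what).

End TwoBlocks.

(* Main.v *)
(* Write H for the block inner product, K for the block stiffness matrix and
   L, S = L H^-1 L^T, P as in the theorem.  L has full row rank, so S is
   positive definite, L P = 0 and P is selfadjoint for H.  Summation by parts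
   gives H D = -K + B, where the Neumann penalties have cancelled every boundary
   term except the interface flux B.  On ker L the flux form vanishes: the two
   interface contributions cancel by norm compatibility.  Hence
   wt^T H (P D P w) = (P wt)^T (H D) (P w) = - (P wt)^T K (P w), so that the
   kinetic and the potential energy have opposite derivatives. *)
Require Import Defs.
From mathcomp Require Import all_boot all_order all_algebra.
From mathcomp Require Import all_classical all_reals all_analysis.
From mathcomp Require Import mxtens ring.
Set Implicit Arguments.
Unset Strict Implicit.
Unset Printing Implicit Defensive.
Import Order.TTheory GRing.Theory Num.Theory.
Import numFieldNormedType.Exports.
Local Open Scope classical_set_scope.
Local Open Scope ring_scope.

(** * Quadratic forms *)

Section QuadraticForms.
Context {R : realType}.

Lemma qformE n (A : 'M[R]_n) (x : 'cV[R]_n) :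
  qform A x = \sum_i \sum_j A i j * (x i 0 * x j 0).
Proof.
rewrite /qform -mulmxA mxE; apply: eq_bigr => i _.
by rewrite !mxE mulr_sumr; apply: eq_bigr => j _; rewrite mulrCA mulrA.
Qed.

Lemma qform_congr m n (A : 'M[R]_m) (P : 'M[R]_(m, n)) (x : 'cV[R]_n) :
  qform (P^T *m A *m P) x = qform A (P *m x).
Proof. by rewrite /qform trmx_mul !mulmxA. Qed.

Lemma qform_diag_block m n (A : 'M[R]_m) (B : 'M[R]_n) (x : 'cV[R]_(m + n)) :
  qform (block_mx A 0 0 B) x = qform A (usubmx x) + qform B (dsubmx x).
Proof.
rewrite /qform -{1 2}[x]vsubmxK tr_col_mx mul_row_block !mulmx0 addr0 add0r.
by rewrite mul_row_col mxE.
Qed.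

Lemma qformZ n c (A : 'M[R]_n) x : qform (c *: A) x = c * qform A x.
Proof. by rewrite /qform -scalemxAr -scalemxAl mxE. Qed.

Lemma possemidefmxD n (A B : 'M[R]_n) :
  possemidefmx A -> possemidefmx B -> possemidefmx (A + B).
Proof.
move=> hA hB x; rewrite /qform mulmxDr mulmxDl mxE.
by rewrite addr_ge0 ?hA ?hB.
Qed.

Lemma possemidefmxZ n c (A : 'M[R]_n) :
  0 <= c -> possemidefmx A -> possemidefmx (c *: A).
Proof. by move=> c0 hA x; rewrite qformZ mulr_ge0. Qed.

Lemma possemidefmx_diag_block m n (A : 'M[R]_m) (B : 'M[R]_n) :
  possemidefmx A -> possemidefmx B -> possemidefmx (block_mx A 0 0 B).
Proof. by move=> hA hB x; rewrite qform_diag_block addr_ge0. Qed.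

Lemma posdefmxW n (A : 'M[R]_n) : posdefmx A -> possemidefmx A.
Proof.
move=> hA x; have [->|/hA/ltW//] := eqVneq x 0.
by rewrite /qform mulmx0 mxE.
Qed.

Lemma posdefmx_diag_block m n (A : 'M[R]_m) (B : 'M[R]_n) :
  posdefmx A -> posdefmx B -> posdefmx (block_mx A 0 0 B).
Proof.
move=> hA hB x x0; rewrite qform_diag_block.
have [u0|/hA u0] := eqVneq (usubmx x) 0; last first.
  by rewrite ltr_pwDl // (posdefmxW hB).
rewrite ltr_wpDl ?(posdefmxW hA) // hB //.
by apply: contraNneq x0 => d0; rewrite -[x]vsubmxK u0 d0 col_mx0.
Qed.

(** [kermx] consists of row vectors, so the hypothesis on columns is applied to the rows of the
    kernel of [A^T]. *)
Lemma unitmx_ker0 n (A : 'M[R]_n) :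
  (forall x : 'cV[R]_n, A *m x = 0 -> x = 0) -> A \in unitmx.
Proof.
move=> A0; rewrite -unitmx_tr -row_free_unit -kermx_eq0.
apply/eqP/row_matrixP => i.
rewrite row0; apply: trmx_inj; rewrite trmx0; apply: A0.
by rewrite -{1}[A]trmxK -trmx_mul -row_mul mulmx_ker row0 trmx0.
Qed.

Lemma posdefmx_unit n (A : 'M[R]_n) : posdefmx A -> A \in unitmx.
Proof.
move=> hA; apply: unitmx_ker0 => x Ax0; apply/eqP/negPn/negP => /hA.
by rewrite /qform -mulmxA Ax0 mulmx0 mxE ltxx.
Qed.

Lemma posdefmx_inv n (A : 'M[R]_n) :
  A^T = A -> posdefmx A -> posdefmx (invmx A).
Proof.
move=> sA hA x x0; have uA := posdefmx_unit hA.
(* Symmetry makes the inverse a congruence of [A], which passes positivity on. *)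
have -> : invmx A = (invmx A)^T *m A *m invmx A.
  by rewrite -mulmxA mulmxV // mulmx1 trmx_inv sA.
rewrite qform_congr hA //; apply: contraNneq x0 => Ax0.
by rewrite -[x](mulKVmx uA) Ax0 mulmx0.
Qed.

Lemma posdefmx_congr m n (A : 'M[R]_m) (P : 'M[R]_(m, n)) :
  posdefmx A -> (forall x : 'cV[R]_n, P *m x = 0 -> x = 0) ->
  posdefmx (P^T *m A *m P).
Proof.
move=> hA P0 x x0; rewrite qform_congr hA //.
by apply: contraNneq x0 => /P0 ->.
Qed.

Lemma posdef_diag_gt0 n (A : 'M[R]_n) i : posdefmx A -> 0 < A i i.
Proof.
move=> hA; suff -> : A i i = qform A (delta_mx i 0).
  apply: hA; apply/eqP => /matrixP/(_ i 0); rewrite !mxE !eqxx => /eqP.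
  by rewrite oner_eq0.
by rewrite /qform trmx_delta -rowE -colE !mxE.
Qed.

Lemma tr_is_diag_mx n (A : 'M[R]_n) : is_diag_mx A -> A^T = A.
Proof. by case/diag_mxP => d ->; rewrite tr_diag_mx. Qed.

Lemma sum_mxtens m n (F : 'I_(m * n) -> R) :
  \sum_k F k = \sum_i \sum_j F (mxtens_index (i, j)).
Proof.
rewrite pair_big /=; rewrite (reindex (@mxtens_index m n)) /=.
  by apply: eq_bigr => -[].
by exists (@mxtens_unindex m n) => k _; rewrite ?mxtens_indexK ?mxtens_unindexK.
Qed.

Lemma sum_diag n (A : 'M[R]_n) (F : 'I_n -> 'I_n -> R) : is_diag_mx A ->
  \sum_i \sum_j A i j * F i j = \sum_i A i i * F i i.
Proof.
move=> /is_diag_mxP dA; apply: eq_bigr => i _.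
rewrite (bigD1 i) //= big1 ?addr0 // => j ji.
by rewrite dA ?mul0r // eq_sym.
Qed.

(** A diagonal left factor makes the Kronecker product block diagonal: grid column [i] carries the
    block [A i i *: B]. *)
Lemma qform_tens_diagl m n (A : 'M[R]_m) (B : 'M[R]_n) x : is_diag_mx A ->
  qform (A *t B) x =
  \sum_i A i i * qform B (\col_j x (mxtens_index (i, j)) 0).
Proof.
move=> dA; under eq_bigr do rewrite qformE.
(* The off-diagonal terms, zero since [A] is diagonal, are put back so that both sides are fourfold
   sums to be compared term by term. *)
rewrite -(sum_diag (fun i k => \sum_j \sum_l
  B j l * ((\col_j x (mxtens_index (i, j)) 0) j 0
        * (\col_j x (mxtens_index (k, j)) 0) l 0))) //.
rewrite qformE sum_mxtens; apply: eq_bigr => i _.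
under eq_bigr do rewrite sum_mxtens; rewrite exchange_big /=.
apply: eq_bigr => k _; rewrite mulr_sumr; apply: eq_bigr => j _.
by rewrite mulr_sumr; apply: eq_bigr => l _; rewrite tensmxE !mxE -mulrA.
Qed.

Lemma qform_tens_diagr m n (A : 'M[R]_m) (B : 'M[R]_n) x : is_diag_mx B ->
  qform (A *t B) x =
  \sum_j B j j * qform A (\col_i x (mxtens_index (i, j)) 0).
Proof.
move=> dB; under eq_bigr do rewrite qformE.
rewrite -(sum_diag (fun j l => \sum_i \sum_k
  A i k * ((\col_i x (mxtens_index (i, j)) 0) i 0
        * (\col_i x (mxtens_index (i, l)) 0) k 0))) //.
rewrite qformE sum_mxtens exchange_big /=; apply: eq_bigr => j _.
transitivity (\sum_i \sum_l \sum_k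
    A i k * B j l * (x (mxtens_index (i, j)) 0 * x (mxtens_index (k, l)) 0)).
  apply: eq_bigr => i _; rewrite sum_mxtens exchange_big /=.
  by apply: eq_bigr => l _; apply: eq_bigr => k _; rewrite tensmxE.
rewrite exchange_big /=; apply: eq_bigr => l _; rewrite mulr_sumr.
apply: eq_bigr => i _; rewrite mulr_sumr; apply: eq_bigr => k _.
by rewrite !mxE -mulrA mulrCA.
Qed.

Lemma possemidefmx_tens_diagl m n (A : 'M[R]_m) (B : 'M[R]_n) :
  is_diag_mx A -> posdefmx A -> possemidefmx B -> possemidefmx (A *t B).
Proof.
move=> dA pA hB x; rewrite qform_tens_diagl // sumr_ge0 // => i _.
by rewrite mulr_ge0 // ltW // posdef_diag_gt0.
Qed.

Lemma possemidefmx_tens_diagr m n (A : 'M[R]_m) (B : 'M[R]_n) :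
  is_diag_mx B -> posdefmx B -> possemidefmx A -> possemidefmx (A *t B).
Proof.
move=> dB pB hA x; rewrite qform_tens_diagr // sumr_ge0 // => i _.
by rewrite mulr_ge0 // ltW // posdef_diag_gt0.
Qed.

(** If the form is zero, each of its nonnegative summands is; as [A i i] is positive, every grid
    column has zero [B]-form and therefore vanishes. *)
Lemma posdefmx_tens_diagl m n (A : 'M[R]_m) (B : 'M[R]_n) :
  is_diag_mx A -> posdefmx A -> posdefmx B -> posdefmx (A *t B).
Proof.
move=> dA pA hB x x0; rewrite lt_neqAle eq_sym.
rewrite (possemidefmx_tens_diagl dA pA (posdefmxW hB)) andbT.
rewrite qform_tens_diagl //; apply: contra x0 => /eqP s0.
apply/eqP/matrixP => k z; rewrite (ord1 z) mxE; case: (mxtens_indexP k) => i j.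
have h0 i' : true -> 0 <= A i' i' *
    qform B (\col_j x (mxtens_index (i', j)) 0).
  by rewrite mulr_ge0 ?(posdefmxW hB) // ltW // posdef_diag_gt0.
have /eqP := psumr_eq0P (fun i _ => h0 i isT) s0 (i := i) isT.
rewrite mulf_eq0 gt_eqF ?posdef_diag_gt0 //= => q0.
have [/matrixP/(_ j 0)|/hB] := eqVneq (\col_j x (mxtens_index (i, j)) 0) 0.
  by rewrite !mxE.
by rewrite (eqP q0) ltxx.
Qed.

End QuadraticForms.

(** * Kronecker products and restrictions to a side *)

Section Kronecker.
Context {R : realType} {mx my : nat}.

Lemma tens11 : (1%:M *t 1%:M : 'M[R]_(mx * my)) = 1%:M.
Proof.
apply/matrixP => i j; case: (mxtens_indexP i) => i0 i1.
case: (mxtens_indexP j) => j0 j1; rewrite tensmxE !mxE -natrM mulnb.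
by rewrite (can_eq (@mxtens_indexK mx my)).
Qed.

Lemma xmxM (A B : 'M[R]_mx) : xmx my (A *m B) = xmx my A *m xmx my B.
Proof. by rewrite /xmx tensmx_mul mulmx1. Qed.

Lemma ymxM (A B : 'M[R]_my) : ymx mx (A *m B) = ymx mx A *m ymx mx B.
Proof. by rewrite /ymx tensmx_mul mulmx1. Qed.

Lemma xmxD (A B : 'M[R]_mx) : xmx my (A + B) = xmx my A + xmx my B.
Proof. by apply/matrixP => i j; rewrite !mxE mulrDl. Qed.

Lemma ymxD (A B : 'M[R]_my) : ymx mx (A + B) = ymx mx A + ymx mx B.
Proof. by apply/matrixP => i j; rewrite !mxE mulrDr. Qed.

Lemma xmxN (A : 'M[R]_mx) : xmx my (- A) = - xmx my A.
Proof. by apply/matrixP => i j; rewrite !mxE mulNr. Qed.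

Lemma ymxN (A : 'M[R]_my) : ymx mx (- A) = - ymx mx A.
Proof. by apply/matrixP => i j; rewrite !mxE mulrN. Qed.

Lemma xymx (A : 'M[R]_mx) (B : 'M[R]_my) : xmx my A *m ymx mx B = A *t B.
Proof. by rewrite /xmx /ymx tensmx_mul mul1mx mulmx1. Qed.

Lemma yxmx (A : 'M[R]_mx) (B : 'M[R]_my) : ymx mx B *m xmx my A = A *t B.
Proof. by rewrite /xmx /ymx tensmx_mul mul1mx mulmx1. Qed.

Lemma xmxV (A : 'M[R]_mx) : A \in unitmx ->
  xmx my A *m invmx (xmx my A) = 1%:M.
Proof.
move=> uA; rewrite mulmxV //.
suff /mulmx1_unit[] : xmx my A *m xmx my (invmx A) = 1%:M by [].
by rewrite -xmxM mulmxV // /xmx tens11.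
Qed.

Lemma ymxV (A : 'M[R]_my) : A \in unitmx ->
  ymx mx A *m invmx (ymx mx A) = 1%:M.
Proof.
move=> uA; rewrite mulmxV //.
suff /mulmx1_unit[] : ymx mx A *m ymx mx (invmx A) = 1%:M by [].
by rewrite -ymxM mulmxV // /ymx tens11.
Qed.

(** Here and in the next three lemmas [k'] is a free variable, so that eliminating [e] turns the
    cast into the identity; at [1 * my = my], where both sides involve [my], this could not be done
    directly. *)
Lemma tr_castmx_mul k k' n (e : k = k') (A B : 'M[R]_(k, n)) :
  (castmx (e, erefl) A)^T *m castmx (e, erefl) B = A^T *m B.
Proof. by case: k' / e; rewrite !castmx_id. Qed.

Lemma castmx_mull k k' l n (e : k = k') (A : 'M[R]_(k, l)) (B : 'M[R]_(l, n)) :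
  castmx (e, erefl) A *m B = castmx (e, erefl) (A *m B).
Proof. by case: k' / e; rewrite !castmx_id. Qed.

Lemma castmx_mul_tr k k' n (e : k = k') (A B : 'M[R]_(k, n)) :
  castmx (e, erefl) A *m (castmx (e, erefl) B)^T = castmx (e, e) (A *m B^T).
Proof. by case: k' / e; rewrite !castmx_id. Qed.

Lemma castmx_mulr k k' n (e : k = k') (A : 'M[R]_k) (B : 'M[R]_(k, n)) :
  castmx (e, e) A *m castmx (e, erefl) B = castmx (e, erefl) (A *m B).
Proof. by case: k' / e; rewrite !castmx_id. Qed.

(** This turns the one-dimensional boundary terms of [sbp_D2] into products of side restrictions. *)
Lemma xmx_outer (r s : 'rV[R]_mx) :
  xmx my (r^T *m s) = (Defs.xrow my r)^T *m Defs.xrow my s.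
Proof. by rewrite tr_castmx_mul trmx_tens tensmx_mul trmx1 mulmx1. Qed.

Lemma ymx_outer (r s : 'rV[R]_my) :
  ymx mx (r^T *m s) = (yrow mx r)^T *m yrow mx s.
Proof. by rewrite tr_castmx_mul trmx_tens tensmx_mul trmx1 mulmx1. Qed.

Lemma castmx_tens1l (B : 'M[R]_my) :
  castmx (mul1n my, mul1n my) ((1%:M : 'M[R]_1) *t B) = B.
Proof.
rewrite tens_scalar_mx castmx_comp scale1r.
by rewrite (eq_irrelevance (etrans _ _) erefl) castmx_id.
Qed.

(** The row acts in x and [B] in y, so they commute; after the restriction [B] acts along the
    side. *)
Lemma xrow_ymx (r : 'rV[R]_mx) (B : 'M[R]_my) :
  Defs.xrow my r *m ymx mx B = B *m Defs.xrow my r.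
Proof.
rewrite -{2}(castmx_tens1l B) castmx_mulr castmx_mull !tensmx_mul.
by rewrite !mul1mx !mulmx1.
Qed.

(** The transposed row spreads a side function over the block with x-profile [s]; restricting by [r]
    then leaves a scalar factor. Such profiles give explicit right factors for [L]. *)
Lemma xrow_mul_tr (r s : 'rV[R]_mx) :
  Defs.xrow my r *m (Defs.xrow my s)^T = ((r *m s^T) 0 0)%:M.
Proof.
rewrite castmx_mul_tr trmx_tens tensmx_mul trmx1 mulmx1.
rewrite [X in X *t _]mx11_scalar tens_scalar_mx castmx_comp scalemx1.
by rewrite (eq_irrelevance (etrans _ _) erefl) castmx_id.
Qed.

End Kronecker.

(** * Discrete Green identities *)

Section Block.
Context {R : realType} {mx my : nat} {xa xb ya yb : R}.
Context (X : sbp_operator mx xa xb) (Y : sbp_operator my ya yb).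

Lemma sbp_H_unit m (a b : R) (O : sbp_operator m a b) : sbp_H O \in unitmx.
Proof. exact/posdefmx_unit/sbp_H_posdef. Qed.

Lemma sbp_HD2 m (a b : R) (O : sbp_operator m a b) : sbp_H O *m sbp_D2 O =
  - sbp_M O + (rowr R m)^T *m sbp_dr O - (rowl R m)^T *m sbp_dl O.
Proof. by rewrite mulKVmx // sbp_H_unit. Qed.

(** This equals [sbp_M X *t sbp_H Y + sbp_H X *t sbp_M Y], the discrete counterpart of the Dirichlet
    form. *)
Definition stiffness := Hy mx Y *m Mx my X + Hx my X *m My mx Y.

Lemma HxHyC : Hx my X *m Hy mx Y = Hy mx Y *m Hx my X.
Proof. by rewrite xymx yxmx. Qed.

Lemma Hx_D2x : Hx my X *m D2x my X =
  - Mx my X + (eE R mx my)^T *m dE my X - (eW R mx my)^T *m dW my X.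
Proof. by rewrite -xmxM sbp_HD2 !xmxD !xmxN !xmx_outer. Qed.

Lemma Hy_D2y : Hy mx Y *m D2y mx Y =
  - My mx Y + (eN R mx my)^T *m dN mx Y - (eS R mx my)^T *m dS mx Y.
Proof. by rewrite -ymxM sbp_HD2 !ymxD !ymxN !ymx_outer. Qed.

(** The block weight in y becomes the inner product along a vertical side; this is how [sbp_H Y]
    enters the interface term. *)
Lemma HyT_xrow (r : 'rV[R]_mx) :
  Hy mx Y *m (Defs.xrow my r)^T = (Defs.xrow my r)^T *m sbp_H Y.
Proof.
apply: trmx_inj; rewrite !trmx_mul !trmxK (tr_is_diag_mx (sbp_H_diag Y)).
by rewrite trmx_tens trmx1 (tr_is_diag_mx (sbp_H_diag Y)) xrow_ymx.
Qed.

Lemma Hbar_xpenalty (A : 'M[R]_(mx * my)) :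
  Hbar X Y *m (invmx (Hx my X) *m A) = Hy mx Y *m A.
Proof.
by rewrite /Hbar HxHyC -mulmxA (mulmxA (Hx my X)) xmxV ?sbp_H_unit // mul1mx.
Qed.

Lemma Hbar_ypenalty (A : 'M[R]_(mx * my)) :
  Hbar X Y *m (invmx (Hy mx Y) *m A) = Hx my X *m A.
Proof.
by rewrite /Hbar -mulmxA (mulmxA (Hy mx Y)) ymxV ?sbp_H_unit // mul1mx.
Qed.

Lemma Hbar_lap_left : Hbar X Y *m lap_left X Y =
  - stiffness + (eE R mx my)^T *m sbp_H Y *m dE my X.
Proof.
rewrite /lap_left mulmxBr !mulmxDr -!(mulmxA (invmx _)) Hbar_xpenalty.
rewrite !Hbar_ypenalty {1}/Hbar HxHyC -!(mulmxA (Hy _ _)) Hx_D2x.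
rewrite /Hbar -!(mulmxA (Hx _ _)) Hy_D2y -HyT_xrow !mulmxBr !mulmxDr !mulmxN.
rewrite -!mulmxA /stiffness opprD.
(* Naming the products makes them atoms for [ring]: [c], [d], [e], [f] are the east, west, north and
   south terms, and the penalties remove all but [c]. *)
set a := _ *m Mx _ _; set b := _ *m My _ _.
set c := _ *m (_ *m dE _ _); set d := _ *m (_ *m dW _ _).
set e := _ *m (_ *m dN _ _); set f := _ *m (_ *m dS _ _).
apply/matrixP => i j; rewrite !mxE; ring.
Qed.

Lemma Hbar_lap_right : Hbar X Y *m lap_right X Y =
  - stiffness - (eW R mx my)^T *m sbp_H Y *m dW my X.
Proof.
rewrite /lap_right mulmxBr !mulmxDr mulmxN -!(mulmxA (invmx _)) Hbar_xpenalty.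
rewrite !Hbar_ypenalty {1}/Hbar HxHyC -!(mulmxA (Hy _ _)) Hx_D2x.
rewrite /Hbar -!(mulmxA (Hx _ _)) Hy_D2y -HyT_xrow !mulmxBr !mulmxDr !mulmxN.
rewrite -!mulmxA /stiffness opprD.
set a := _ *m Mx _ _; set b := _ *m My _ _.
set c := _ *m (_ *m dE _ _); set d := _ *m (_ *m dW _ _).
set e := _ *m (_ *m dN _ _); set f := _ *m (_ *m dS _ _).
apply/matrixP => i j; rewrite !mxE; ring.
Qed.

Lemma stiffness_sym : stiffness^T = stiffness.
Proof.
rewrite /stiffness yxmx xymx linearD /= !trmx_tens !sbp_M_sym.
by rewrite !tr_is_diag_mx ?sbp_H_diag.
Qed.

Lemma stiffness_psd : possemidefmx stiffness.
Proof.
rewrite /stiffness yxmx xymx; apply: possemidefmxD.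
  exact: possemidefmx_tens_diagr (sbp_H_diag Y) (sbp_H_posdef Y) (sbp_M_psd X).
exact: possemidefmx_tens_diagl (sbp_H_diag X) (sbp_H_posdef X) (sbp_M_psd Y).
Qed.

Lemma Hbar_sym : (Hbar X Y)^T = Hbar X Y.
Proof. by rewrite /Hbar xymx trmx_tens !tr_is_diag_mx ?sbp_H_diag. Qed.

Lemma Hbar_posdef : posdefmx (Hbar X Y).
Proof.
rewrite /Hbar xymx.
exact: posdefmx_tens_diagl (sbp_H_diag X) (sbp_H_posdef X) (sbp_H_posdef Y).
Qed.

End Block.

(** * Derivatives of quadratic forms *)

Section Derivative.
Context {R : realType}.

Lemma bilinear_sym n (A : 'M[R]_n) (x y : 'cV[R]_n) : A^T = A ->
  (x^T *m A *m y) 0 0 = (y^T *m A *m x) 0 0.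
Proof.
move=> sA; transitivity ((x^T *m A *m y)^T 0 0); first by rewrite [RHS]mxE.
by rewrite !trmx_mul trmxK sA mulmxA.
Qed.

(** The cross terms cancel by symmetry. Along a curve, this makes the difference quotient of the
    form bilinear in the difference quotient of the curve and the sum of its two values. *)
Lemma qformB n (A : 'M[R]_n) (x y : 'cV[R]_n) : A^T = A ->
  ((x - y)^T *m A *m (x + y)) 0 0 = qform A x - qform A y.
Proof.
move=> sA; have := bilinear_sym x y sA.
rewrite /qform linearB /= !mulmxBl !mulmxDr.
move: (x^T *m A *m x) (x^T *m A *m y) (y^T *m A *m x) (y^T *m A *m y).
by move=> xx xy yx yy e; rewrite !mxE e opprD addrA addrK.
Qed.

Lemma cvg_bilinear (T : Type) (F : set_system T) {FF : Filter F} m n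
    (A : 'M[R]_(m, n)) (f : T -> 'cV[R]_m) (g : T -> 'cV[R]_n)
    (a : 'cV[R]_m) (b : 'cV[R]_n) :
  f @ F --> a -> g @ F --> b ->
  ((f x)^T *m A *m g x) 0 0 @[x --> F] --> ((a^T *m A *m b) 0 0 : R^o).
Proof.
move=> fa gb.
(* The entry is a finite sum of products of coordinates, so limits of coordinates suffice. *)
have E (u : 'cV[R]_m) (v : 'cV[R]_n) :
    (u^T *m A *m v) 0 0 = \sum_j (\sum_i u i 0 * A i j) * v j 0.
  rewrite mxE; apply: eq_bigr => j _; rewrite mxE; congr (_ * _).
  by apply: eq_bigr => i _; rewrite mxE.
rewrite E; under eq_cvg do rewrite E.
apply: cvg_big => [|j _]; first exact: add_continuous.
  apply: cvgM; last first.
  exact: continuous_cvg (@coord_continuous _ _ _ j 0 b) gb.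
apply: cvg_big => [|i _]; first exact: add_continuous.
  apply: cvgM; last exact: cvg_cst.
exact: continuous_cvg (@coord_continuous _ _ _ i 0 a) fa.
Qed.

(** Off [t], [f s] is [f t] plus [s - t] times the difference quotient; the first factor tends to 0
    and the second to [l]. *)
Lemma has_derivative_within_cvg (V : normedModType R) (A : set R)
    (f : R -> V) t l :
  has_derivative_within A f t l -> f s @[s --> within A (t^')] --> f t.
Proof.
move=> fl.
have st : (s - t) @[s --> within A (t^')] --> (0 : R).
  rewrite -(subrr t); apply: cvgB; last exact: cvg_cst.
  by do 2!apply: cvg_within_filter; exact: cvg_id.
have FF : Filter (within A t^') by exact: within_filter.
have : f t + (s - t) *: ((s - t)^-1 *: (f s - f t)) @[s --> within A (t^')]
    --> f t + 0 *: l by apply: cvgD; [exact: cvg_cst | exact: cvgZ].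
rewrite scale0r addr0.
apply: cvg_trans; apply: near_eq_cvg.
have : \forall s \near within A (t^'), s != t.
  exact: cvg_within (nbhs_dnbhs_neq t).
apply: filterS => s st0.
by rewrite scalerA mulfV ?subr_eq0 // scale1r addrC subrK.
Qed.

Lemma has_derivative_within_qform n (S : 'M[R]_n) (A : set R)
    (f : R -> 'cV[R]_n) t l : S^T = S ->
  has_derivative_within A f t l ->
  has_derivative_within A (fun s => qform S (f s) : R^o) t
    (2 * ((f t)^T *m S *m l) 0 0).
Proof.
move=> sS fl.
have fs := has_derivative_within_cvg fl.
have FF : Filter (within A t^') by exact: within_filter.
have fs2 : f s + f t @[s --> within A (t^')] --> f t + f t.
  by apply: cvgD => //; exact: cvg_cst.
have := @cvg_bilinear _ _ FF _ _ S _ _ _ _ fl fs2.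
have -> : (l^T *m S *m (f t + f t)) 0 0 = 2 * ((f t)^T *m S *m l) 0 0.
  by rewrite mulmxDr mxE bilinear_sym // mulr_natl.
apply: cvg_trans; apply: near_eq_cvg; apply: nearW => s /=.
rewrite linearZ /= -!scalemxAl mxE; congr (_ * _).
by rewrite qformB.
Qed.

Lemma has_derivative_withinD (V : normedModType R) (A : set R)
    (f g : R -> V) t l l' :
  has_derivative_within A f t l -> has_derivative_within A g t l' ->
  has_derivative_within A (fun s => f s + g s) t (l + l').
Proof.
move=> fl gl.
have FF : Filter (within A t^') by exact: within_filter.
have : (s - t)^-1 *: (f s - f t) + (s - t)^-1 *: (g s - g t)
    @[s --> within A (t^')] --> l + l' by exact: cvgD.
apply: cvg_trans; apply: near_eq_cvg.
by apply: nearW => s; rewrite -scalerDr opprD addrACA.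
Qed.

End Derivative.

(** * The projection onto the kernel of L *)

Section Projection.
Context {R : realType} {k n : nat}.
Context (H D K B : 'M[R]_n) (L : 'M[R]_(k, n)).
Hypotheses (H_sym : H^T = H) (H_posdef : posdefmx H).
Hypothesis kerLT : forall z : 'cV[R]_k, L^T *m z = 0 -> z = 0.
Let S := L *m invmx H *m L^T.
Let P := 1%:M - invmx H *m L^T *m invmx S *m L.

Lemma schur_unit : S \in unitmx.
Proof.
(* Reading the first [L] as the transpose of [L^T] displays [S] as a congruence of [invmx H] by the
   injective [L^T]. *)
apply: posdefmx_unit; rewrite /S -{1}[L]trmxK.
exact: posdefmx_congr (posdefmx_inv H_sym H_posdef) kerLT.
Qed.

Lemma mul_projection : L *m P = 0.
Proof.
rewrite mulmxBr mulmx1 !mulmxA -/S.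
by rewrite mulmxV ?schur_unit // mul1mx subrr.
Qed.

(** [H *m P] equals [H - L^T S^-1 L], which is symmetric because [H] and [S] are. *)
Lemma projection_selfadjoint : H *m P = P^T *m H.
Proof.
have S_sym : S^T = S by rewrite /S !trmx_mul trmxK trmx_inv H_sym mulmxA.
have HP : H *m P = H - L^T *m invmx S *m L.
  by rewrite mulmxBr mulmx1 -!mulmxA mulKVmx // posdefmx_unit.
apply: trmx_inj; rewrite [RHS]trmx_mul trmxK H_sym HP.
by rewrite linearB /= !trmx_mul trmxK H_sym trmx_inv S_sym mulmxA.
Qed.

(** Selfadjointness moves the left [P] onto [wt], so that both arguments of [B] lie in the kernel of
    [L] even if [wt] itself violates the interface conditions. *)
Lemma projected_energy_balance (w wt : 'cV[R]_n) :
  H *m D = - K + B ->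
  (forall x y : 'cV[R]_n, L *m x = 0 -> L *m y = 0 -> x^T *m B *m y = 0) ->
  wt^T *m H *m (P *m D *m P *m w) = - (wt^T *m (P^T *m K *m P) *m w).
Proof.
move=> HD B0.
have LP (x : 'cV[R]_n) : L *m (P *m x) = 0.
  by rewrite mulmxA mul_projection mul0mx.
rewrite -!mulmxA (mulmxA H) projection_selfadjoint -!mulmxA (mulmxA H) HD.
rewrite mulmxDl !mulmxDr mulNmx !mulmxN.
have := B0 _ _ (LP wt) (LP w); rewrite trmx_mul -!mulmxA => ->.
by rewrite addr0.
Qed.

End Projection.

(** * The interface *)

Section Interface.
Context {R : realType} {mxu myu mxv myv : nat} {xL xI xR yS yN : R}.
Context (Xu : sbp_operator mxu xL xI) (Yu : sbp_operator myu yS yN).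
Context (Xv : sbp_operator mxv xI xR) (Yv : sbp_operator myv yS yN).
Context (c1 c2 : R) (Iv2u : 'M[R]_(myu, myv)) (Iu2v : 'M[R]_(myv, myu)).
Hypotheses (mxu_gt0 : (0 < mxu)%N) (c2_gt0 : 0 < c2).
Hypothesis hI : norm_compatible Yu Yv Iv2u Iu2v.

Let L := interfaceL Xu Xv c1 c2 Iv2u Iu2v.

Lemma rowr_const m : (0 < m)%N -> rowr R m *m const_mx 1 = 1%:M :> 'M[R]_1.
Proof.
move=> m_gt0; apply/matrixP => i j; rewrite !ord1 !mxE eqxx.
have lt : (m.-1 < m)%N by rewrite prednK.
rewrite (bigD1 (Ordinal lt)) //= !mxE eqxx mulr1 big1 ?addr0 // => k.
by rewrite !mxE -val_eqE /= => /negPf ->; rewrite mul0r.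
Qed.

(* Constants in x on the left block and the grid coordinate in x on the right
   block give a right factor Q making L Q block triangular. *)
Lemma interfaceL_tr_ker0 (z : 'cV[R]_(myu + myv)) : L^T *m z = 0 -> z = 0.
Proof.
move=> /(congr1 trmx); rewrite trmx_mul trmxK trmx0 => zL.
pose Q := block_mx (Defs.xrow myu (const_mx 1 : 'cV[R]_mxu)^T)^T 0
                   0 (Defs.xrow myv (grid mxv xI xR)^T)^T.
have xrow_lift m my (r : 'rV[R]_m) (v : 'cV[R]_m) a : r *m v = a%:M ->
    Defs.xrow my r *m (Defs.xrow my v^T)^T = a%:M.
  by move=> rv; rewrite xrow_mul_tr trmxK rv mxE eqxx mulr1n.
have /(congr1 (mulmx^~ Q)) := zL; rewrite mul0mx -[z^T]hsubmxK -mulmxA.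
rewrite mulmx_block !mulmx0 !addr0 !add0r -!scalemxAl.
rewrite -!mulmxA !mulNmx -!scalemxAl.
rewrite (xrow_lift _ _ _ _ _ (rowr_const mxu_gt0)).
rewrite (xrow_lift _ _ _ _ 0); last first.
  by rewrite sbp_dr_const raddf0.
rewrite (xrow_lift _ _ _ _ _ (sbp_dl_grid Xv)).
rewrite raddf0 mulmx0 scaler0 mul_row_block !mulmx1 mulmx0 addr0.
(* The diagonal blocks of [L Q] are the identity and [-c2^2] times the identity, and the lower left
   block is 0: the first block column kills the upper part of [z], then the second kills the lower
   part. *)
rewrite -row_mx0 => /eq_row_mx[zu0].
rewrite zu0 mul0mx add0r mulmxN -scalemxAr mulmx1 => /eqP.
rewrite oppr_eq0 scaler_eq0 sqrf_eq0 gt_eqF //= => /eqP zv0.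
by apply: trmx_inj; rewrite -[z^T]hsubmxK zu0 zv0 row_mx0 trmx0.
Qed.

Definition globalK : 'M[R]_(mxu * myu + mxv * myv) :=
  block_mx (c1 ^+ 2 *: stiffness Xu Yu) 0 0 (c2 ^+ 2 *: stiffness Xv Yv).
(** The opposite signs are those of the outward normals: the interface is the east side of the left
    block and the west side of the right block. *)
Definition interface_flux : 'M[R]_(mxu * myu + mxv * myv) :=
  block_mx (c1 ^+ 2 *: ((eE R mxu myu)^T *m sbp_H Yu *m dE myu Xu)) 0
    0 (- (c2 ^+ 2 *: ((eW R mxv myv)^T *m sbp_H Yv *m dW myv Xv))).

Lemma globalH_D :
  globalH Xu Yu Xv Yv *m globalD Xu Yu Xv Yv c1 c2 = - globalK + interface_flux.
Proof.
rewrite mulmx_block !mulmx0 !mul0mx !addr0 !add0r -!scalemxAr.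
rewrite Hbar_lap_left Hbar_lap_right opp_block_mx add_block_mx oppr0 !addr0.
by congr block_mx; rewrite ?oppr0 // scalerDr !scalerN.
Qed.

(** Continuity of [x] makes its left trace the interpolant of its right trace; norm compatibility
    moves the interpolation onto the left flux of [y], which the flux condition identifies with the
    right flux. *)
Lemma interface_flux0 (x y : 'cV[R]_(mxu * myu + mxv * myv)) :
  L *m x = 0 -> L *m y = 0 -> x^T *m interface_flux *m y = 0.
Proof.
rewrite -[x]vsubmxK -[y]vsubmxK.
move: (usubmx x) (dsubmx x) (usubmx y) (dsubmx y) => xu xv yu yv.
rewrite /L /interfaceL !mul_block_col -!col_mx0.
move=> /eq_col_mx[/eqP + _] /eq_col_mx[_ /eqP].
rewrite !mulNmx !subr_eq0 -!scalemxAl -!mulmxA => /eqP jump /eqP flux.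
rewrite tr_col_mx mul_block_col !mul0mx addr0 add0r mul_row_col.
rewrite mulNmx -!scalemxAl mulmxN -!scalemxAr -!mulmxA.
rewrite (mulmxA xu^T) -trmx_mul jump (mulmxA xv^T) -trmx_mul.
rewrite (mulmxA _ (sbp_H Yu)) hI -mulmxA.
by rewrite !(scalemxAr _ _^T) !(scalemxAr _ (sbp_H Yv)) flux subrr.
Qed.

Lemma globalH_sym : (globalH Xu Yu Xv Yv)^T = globalH Xu Yu Xv Yv.
Proof. by rewrite tr_block_mx !trmx0 !Hbar_sym. Qed.

Lemma globalH_posdef : posdefmx (globalH Xu Yu Xv Yv).
Proof. exact: posdefmx_diag_block (Hbar_posdef _ _) (Hbar_posdef _ _). Qed.

Lemma globalK_sym : globalK^T = globalK.
Proof. by rewrite tr_block_mx !trmx0 !linearZ /= !stiffness_sym. Qed.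

Lemma globalK_psd : possemidefmx globalK.
Proof.
by apply: possemidefmx_diag_block; apply: possemidefmxZ;
  rewrite ?sqr_ge0 //; apply: stiffness_psd.
Qed.

Lemma energyE wt what : energy Xu Yu Xv Yv c1 c2 wt what =
  qform (globalH Xu Yu Xv Yv) wt + qform globalK what.
Proof. by rewrite !qform_diag_block !qformZ addrACA addrA. Qed.

End Interface.

(** * Assembly of the energy balance *)

Theorem lemma4p1 (R : realType)
    (mxu myu mxv myv : nat)
    (hmxu : (2 <= mxu)%N) (hmyu : (2 <= myu)%N)
    (hmxv : (2 <= mxv)%N) (hmyv : (2 <= myv)%N)
    (xL xI xR yS yN : R)
    (hxLI : xL < xI) (hxIR : xI < xR) (hySN : yS < yN)
    (Xu : sbp_operator mxu xL xI) (Yu : sbp_operator myu yS yN)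
    (Xv : sbp_operator mxv xI xR) (Yv : sbp_operator myv yS yN)
    (c1 c2 : R) (hc1 : 0 < c1) (hc2 : 0 < c2)
    (Iv2u : 'M[R]_(myu, myv)) (Iu2v : 'M[R]_(myv, myu))
    (hI : norm_compatible Yu Yv Iv2u Iu2v) :
  let D := globalD Xu Yu Xv Yv c1 c2 in
  let Hhat := globalH Xu Yu Xv Yv in
  let L := interfaceL Xu Xv c1 c2 Iv2u Iu2v in
  let P := 1%:M - invmx Hhat *m L^T *m invmx (L *m invmx Hhat *m L^T) *m L in
  (L *m invmx Hhat *m L^T) \in unitmx /\
  forall w wt : R -> 'cV[R]_(mxu * myu + mxv * myv),
    (forall t : R, 0 <= t -> has_derivative_within `[0, +oo[ w t (wt t)) ->
    (forall t : R, 0 <= t ->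
       has_derivative_within `[0, +oo[ wt t (P *m D *m P *m w t)) ->
    let E := fun t : R =>
      (energy Xu Yu Xv Yv c1 c2 (wt t) (P *m w t) : R^o) in
    forall t : R, 0 <= t ->
      0 <= E t /\ has_derivative_within `[0, +oo[ E t 0.
Proof.
move=> D Hhat L P.
have kerLT (z : 'cV[R]_(myu + myv)) : L^T *m z = 0 -> z = 0.
  by apply: interfaceL_tr_ker0; rewrite // ltnW.
have Hsym : Hhat^T = Hhat := globalH_sym Xu Yu Xv Yv.
have Hpd : posdefmx Hhat := globalH_posdef Xu Yu Xv Yv.
split; first exact: schur_unit.
move=> w wt dw dwt E t t0.
split.
  by rewrite /E energyE addr_ge0 ?(posdefmxW Hpd) ?globalK_psd.
pose K := globalK Xu Yu Xv Yv c1 c2.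
have Ksym : (P^T *m K *m P)^T = P^T *m K *m P.
  by rewrite !trmx_mul trmxK globalK_sym mulmxA.
(* The projection is absorbed into the matrix, so that both forms are evaluated on curves whose
   derivatives are given. *)
have -> : E = fun s => qform Hhat (wt s) + qform (P^T *m K *m P) (w s).
  by apply/funext => s; rewrite /E energyE qform_congr.
have := has_derivative_withinD (has_derivative_within_qform Hsym (dwt t t0))
  (has_derivative_within_qform Ksym (dw t t0)).
rewrite (projected_energy_balance Hsym Hpd kerLT _ _ (globalH_D _ _ _ _ _ _)).
  (* Symmetry of [P^T K P] exchanges [w] and [wt], which makes the two derivatives opposite. *)
  by rewrite mxE (bilinear_sym _ _ Ksym) mulrN addNr.
by move=> x y; apply: interface_flux0.
Qed.
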